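(* If $m$ is a non-negative integer, then \[ \begin{aligned} &\sum_{n=1}^\infty\frac{2^{2n}O_{n+m}}{n(n+1)(n+2)(n+3)\binom{2(n+m)}{n+m}\binom{n+m}{m}}\\ &\quad=\frac{1}{2\binom{2m}{m}}\left(\frac16\left(m-\frac12\right)\left(m+\frac12\right)\left(m+\frac32\right)O_m-\frac{m^2}4-\frac m4+\frac1{48}\right)\left(4O_m^{(2)}-3\zeta(2)\right)\\ &\qquad+\frac{1}{12\binom{2m}{m}}\left(m-\frac12\right)\left(m+\frac12\right)\left(m+\frac32\right)\left(8O_m^{(3)}-7\zeta(3)\right)\\ &\qquad+\frac{1}{2\binom{2m}{m}}\left(\frac1{36}\left(6m^2+9m-2\right)O_m-\frac m6-\frac18\right). \end{aligned} \] In particular, \[ \sum_{n=1}^\infty\frac{2^{2n}O_n}{n(n+1)(n+2)(n+3)\binom{2n}{n}}=\frac7{32}\zeta(3)-\frac{\pi^2}{192}-\frac1{16},\qquad \sum_{n=1}^\infty\frac{2^{2n}O_{n+1}}{n(n+1)^2(n+2)(n+3)\binom{2(n+1)}{n+1}}=\frac{137}{288}+\frac{\pi^2}{48}-\frac{35}{64}\zeta(3). \]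
   Context: $\zeta$ is the Riemann zeta function. For nonnegative integer $m$ and positive integer $r$, $O_m^{(r)}=\sum_{j=1}^m(2j-1)^{-r}$ (empty sum $=0$), $O_m=O_m^{(1)}$. *)

(* Defs.v *)
From Stdlib Require Import Reals.
From Coquelicot Require Import Coquelicot.
Open Scope R_scope.

(** Riemann zeta function on its half-line of absolute convergence [s > 1];
    for [s <= 1] the value is a junk value of the total operator [Series]. *)
Definition zeta (s : R) : R := Series (fun k : nat => / Rpower (INR (S k)) s).

(** [sum_n_m a 1 0] is the empty sum, so [odd_harmonic r 0 = 0]. *)
Definition odd_harmonic (r m : nat) : R :=
  sum_n_m (fun j : nat => / (2 * INR j - 1) ^ r) 1 m.

(** Central binomial coefficient, with values in [R]; [Binomial.C] is qualified
    because Coquelicot uses [C] for the complex numbers. *)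
Definition central_binom (n : nat) : R := Binomial.C (2 * n) n.

(** [sum_{n >= 1} a n] converges to [l]. *)
Definition is_series_from1 (a : nat -> R) (l : R) : Prop :=
  is_series (fun k : nat => a (S k)) l.

(* Main.v *)
Require Import Defs.
From Stdlib Require Import Reals Lra Lia.
From Coquelicot Require Import Coquelicot.
Open Scope R_scope.

(** Put a = m + 1/2, b_n = B(a, n) = (n-1)!/(a)_n and H_n = sum_{j<n} 1/(a+j).
    The n-th summand, multiplied by binom(2m, m), is
    (O_m + H_n/2) b_n / ((n+1)(n+2)(n+3)).  Gosper summation reduces
    sum b_n / ((n+1)(n+2)(n+3)) to sum b_n / n, and minus the derivative of this
    reduction in a, where d b_n / da = - b_n H_n, handles the factor H_n.
    The shift a -> a + 1 changes b_n / n by a telescoping term, so that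
    sum b_n / n = sum_k 1/(a+k)^2 and, differentiating again,
    sum b_n H_n / n = sum_k 2/(a+k)^3.  These are tails of the series for
    3 zeta(2) and 14 zeta(3).  The value of zeta(2) comes from iterating
    1/sin^2 x = (1/sin^2 (x/2) + 1/sin^2 (pi/2 - x/2)) / 4 from x = pi/4
    and 1/sin^2 x - 1 <= 1/x^2 <= 1/sin^2 x. *)

(** * Beta values and their harmonic factors: shifts, bounds and limits *)

(* Closed form: [beta a k] = B(a, k+1) = k! / (a (a+1) ... (a+k)). *)
Fixpoint beta (a : R) (k : nat) : R :=
  match k with
  | O => / a
  | S j => beta a j * (INR j + 1) / (a + INR j + 1)
  end.

(** Minus the logarithmic derivative of [beta a k] in [a]; this is H_n with n = k + 1. *)
Fixpoint harm (a : R) (k : nat) : R :=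
  match k with
  | O => / a
  | S j => harm a j + / (a + INR j + 1)
  end.

Lemma beta_pos (a : R) (k : nat) : 0 < a -> 0 < beta a k.
Proof.
  intros Ha; induction k as [|k IH]; cbn [beta].
  - now apply Rinv_0_lt_compat.
  - pose proof (pos_INR k).
    apply Rdiv_lt_0_compat; [apply Rmult_lt_0_compat|]; lra.
Qed.

Lemma harm_pos (a : R) (k : nat) : 0 < a -> 0 < harm a k.
Proof.
  intros Ha; induction k as [|k IH]; cbn [harm].
  - now apply Rinv_0_lt_compat.
  - pose proof (pos_INR k).
    assert (0 < / (a + INR k + 1)) by (apply Rinv_0_lt_compat; lra). lra.
Qed.

Lemma beta_shift (a : R) (k : nat) :
  0 < a -> beta (a + 1) k = beta a k * a / (a + INR k + 1).
Proof.
  intros Ha; induction k as [|k IH]; cbn [beta].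
  - simpl; field; lra.
  - rewrite IH, S_INR. pose proof (pos_INR k). field; lra.
Qed.

Lemma harm_shift (a : R) (k : nat) :
  0 < a -> harm (a + 1) k = harm a k - / a + / (a + INR k + 1).
Proof.
  intros Ha; induction k as [|k IH]; cbn [harm].
  - simpl; field; lra.
  - rewrite IH, S_INR. pose proof (pos_INR k). field; lra.
Qed.

(** With x = k, the left side changes by the factor (x+1)(x+2)/(a+x+1)^2 from k to k+1, and this is
    at most 1 because (x+3/2)^2 > (x+1)(x+2). The resulting decay k^(-1/2) is the true order at a =
    1/2. *)
Lemma beta_sqr_le (a : R) (k : nat) :
  1 / 2 <= a -> beta a k ^ 2 * (INR k + 1) <= (/ a) ^ 2.
Proof.
  intros Ha; induction k as [|k IH]; cbn [beta].
  - simpl; lra.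
  - apply Rle_trans with (2 := IH).
    rewrite S_INR. pose proof (pos_INR k). set (x := INR k) in *.
    replace ((beta a k * (x + 1) / (a + x + 1)) ^ 2 * (x + 1 + 1)) with
      (beta a k ^ 2 * (x + 1) * ((x + 1) * (x + 2) / (a + x + 1) ^ 2))
      by (field; lra).
    rewrite <- (Rmult_1_r (beta a k ^ 2 * (x + 1))) at 2.
    apply Rmult_le_compat_l.
    + apply Rmult_le_pos; [apply pow2_ge_0 | lra].
    + apply Rle_div_l; [apply pow_lt; lra | nra].
Qed.

(* The product with the second Taylor polynomial of [exp] at [a * harm a k]
   decreases, because [beta a (S k) / beta a k = 1 - x] where [x] is the
   increment of [a * harm a k]. *)
Lemma beta_harm_le (a : R) (k : nat) :
  0 < a ->
  beta a k * (1 + a * harm a k + (a * harm a k) ^ 2 / 2) <= 5 / 2 * / a.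
Proof.
  intros Ha; induction k as [|k IH]; cbn [beta harm].
  - right; field; lra.
  - apply Rle_trans with (2 := IH).
    pose proof (pos_INR k).
    pose proof (beta_pos a k Ha). pose proof (harm_pos a k Ha) as Hh.
    assert (0 < a * harm a k) as Hp by (now apply Rmult_lt_0_compat).
    assert (0 < a / (a + INR k + 1)) as Hx by (apply Rdiv_lt_0_compat; lra).
    replace (beta a k * (INR k + 1) / (a + INR k + 1)) with
      (beta a k * (1 - a / (a + INR k + 1))) by (field; lra).
    replace (a * (harm a k + / (a + INR k + 1))) with
      (a * harm a k + a / (a + INR k + 1)) by (field; lra).
    rewrite Rmult_assoc. apply Rmult_le_compat_l; [lra|].
    set (h := a * harm a k) in *. set (x := a / (a + INR k + 1)) in *.
    (* With P(h) = 1 + h + h^2/2, the product (1 - x) P(h + x) equals P(h) - (x h^2 + x^2 + 2 x^2 h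
       + x^3)/2. *)
    assert (0 <= x * h ^ 2) by (apply Rmult_le_pos; nra).
    assert (0 <= x ^ 2 * h) by (apply Rmult_le_pos; nra).
    assert (0 <= x ^ 3) by (apply pow_le; lra).
    nra.
Qed.

Lemma inv_add_lim (c : R) : is_lim_seq (fun k => / (INR k + c)) 0.
Proof.
  replace (Finite 0) with (Rbar_inv p_infty) by reflexivity.
  apply is_lim_seq_inv; [|easy].
  apply is_lim_seq_plus with p_infty c; [|apply is_lim_seq_const|easy].
  apply is_lim_seq_INR.
Qed.

Lemma beta_lim (a : R) : 1 / 2 <= a -> is_lim_seq (beta a) 0.
Proof.
  intros Ha.
  apply is_lim_seq_le_le with
    (u := fun _ => 0) (w := fun k => / a * sqrt (/ (INR k + 1))).
  - intros k. pose proof (beta_pos a k ltac:(lra)). split; [lra|].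
    pose proof (pos_INR k).
    assert (0 < / a) by (apply Rinv_0_lt_compat; lra).
    assert (0 < / (INR k + 1)) by (apply Rinv_0_lt_compat; lra).
    apply Rsqr_incr_0_var.
    + rewrite Rsqr_mult, Rsqr_sqrt by lra.
      pose proof (beta_sqr_le a k Ha). rewrite !Rsqr_pow2.
      apply Rle_div_r with (c := INR k + 1); lra.
    + apply Rmult_le_pos; [lra | apply sqrt_pos].
  - apply is_lim_seq_const.
  - replace (Finite 0) with (Rbar_mult (/ a) (sqrt 0))
      by (simpl; now rewrite sqrt_0, Rmult_0_r).
    apply is_lim_seq_scal_l.
    apply (is_lim_seq_continuous sqrt); [|apply inv_add_lim].
    apply continuity_pt_sqrt; lra.
Qed.

(** The quadratic term in [beta_harm_le] bounds [beta a k * (a * harm a k) ^ 2] by 5/a, so the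
    square of [beta a k * harm a k] is at most 5/a^3 times [beta a k], which tends to 0. *)
Lemma beta_harm_lim (a : R) :
  1 / 2 <= a -> is_lim_seq (fun k => beta a k * harm a k) 0.
Proof.
  intros Ha.
  apply is_lim_seq_le_le with
    (u := fun _ => 0) (w := fun k => sqrt (5 / a ^ 3 * beta a k)).
  - intros k.
    pose proof (beta_pos a k ltac:(lra)). pose proof (harm_pos a k ltac:(lra)).
    assert (0 < 5 / a ^ 3) by (apply Rdiv_lt_0_compat; [lra|apply pow_lt; lra]).
    split; [nra|].
    apply Rsqr_incr_0_var; [|apply sqrt_pos].
    rewrite Rsqr_sqrt by nra.
    assert (beta a k * (a * harm a k) ^ 2 <= 5 * / a).
    { pose proof (beta_harm_le a k ltac:(lra)).
      assert (0 < a * harm a k) by (apply Rmult_lt_0_compat; lra).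
      nra. }
    replace (Rsqr (beta a k * harm a k)) with
      (/ a ^ 2 * (beta a k * (a * harm a k) ^ 2) * beta a k)
      by (unfold Rsqr; field; lra).
    replace (5 / a ^ 3) with (/ a ^ 2 * (5 * / a)) by (field; lra).
    apply Rmult_le_compat_r; [lra|].
    apply Rmult_le_compat_l; [|easy].
    left; apply Rinv_0_lt_compat, pow_lt; lra.
  - apply is_lim_seq_const.
  - replace (Finite 0) with (Finite (sqrt (5 / a ^ 3 * 0)))
      by (now rewrite Rmult_0_r, sqrt_0).
    apply (is_lim_seq_continuous sqrt (fun k => 5 / a ^ 3 * beta a k)).
    + apply continuity_pt_sqrt; lra.
    + apply (is_lim_seq_scal_l (beta a) (5 / a ^ 3) 0). now apply beta_lim.
Qed.

(** * Telescoping series and the shift of the parameter *)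

Lemma is_series_telescope (u : nat -> R) :
  is_lim_seq u 0 -> is_series (fun k => u k - u (S k)) (u O).
Proof.
  intros Hu.
  change (is_lim_seq (sum_n (fun k => u k - u (S k))) (u O)).
  apply is_lim_seq_ext with (u := fun n => u O - u (S n)).
  - intros n; induction n as [|n IH].
    + now rewrite sum_O.
    + rewrite sum_Sn, <- IH. unfold plus; simpl; ring.
  - replace (Finite (u O)) with (Finite (u O - 0)) by (f_equal; ring).
    apply is_lim_seq_minus'; [apply is_lim_seq_const|].
    now apply -> is_lim_seq_incr_1.
Qed.

(** Up to the factor 2/x, this is the majorant in [is_series_shift]. *)
Lemma is_series_inv_consecutive :
  is_series (fun k => / ((INR k + 1) * (INR k + 2))) 1.
Proof.
  pose proof (is_series_telescope (fun k => / (INR k + 1)) (inv_add_lim 1)) as H.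
  cbv beta in H. replace (/ (INR 0 + 1)) with 1 in H by (simpl; field).
  apply is_series_ext with (fun k => / (INR k + 1) - / (INR (S k) + 1)).
  - intros k. pose proof (pos_INR k). rewrite S_INR.
    change (/ (INR k + 1) - / (INR k + 1 + 1) = / ((INR k + 1) * (INR k + 2))).
    field; lra.
  - exact H.
Qed.

(* Iterating the shift [a -> a + 1] gives [sum_k u a k = sum_{j<K} g (a+j) +
   sum_k u (a+K) k], and the last sum is at most [2 / (a + K)]. *)
Lemma is_series_shift (u : R -> nat -> R) (g : R -> R) (a : R) :
  (forall x, 1 / 2 <= x -> is_series (fun k => u x k - u (x + 1) k) (g x)) ->
  (forall x k, 2 <= x ->
     0 <= u x k <= 2 / x * / ((INR k + 1) * (INR k + 2))) ->
  1 / 2 <= a ->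
  is_series (u a) (Series (u a)) /\
  is_series (fun k => g (a + INR k)) (Series (u a)).
Proof.
  intros Hg Hu Ha.
  assert (Hbd : forall x, 2 <= x ->
            is_series (fun k => 2 / x * / ((INR k + 1) * (INR k + 2))) (2 / x)).
  { intros x Hx. 
    pose proof (is_series_scal_l (2 / x) _ _ is_series_inv_consecutive) as H.
    unfold mult in H; simpl in H. now rewrite Rmult_1_r in H. }
  assert (Hex2 : forall x, 2 <= x -> ex_series (u x)).
  { intros x Hx.
    apply @ex_series_le with (fun k => 2 / x * / ((INR k + 1) * (INR k + 2))).
    - intros k. unfold norm; simpl; unfold abs; simpl.
      rewrite Rabs_pos_eq; now apply Hu.
    - eexists; now apply Hbd. }
  (* The majorant is available only for x >= 2. Convergence passes from x + 1 back to x, and two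
     such steps cover every x >= 1/2. *)
  assert (Hstep : forall x, 1 / 2 <= x -> ex_series (u (x + 1)) -> ex_series (u x)).
  { intros x Hx Hex.
    apply ex_series_ext with (fun k => plus (u x k - u (x + 1) k) (u (x + 1) k)).
    - intros k; unfold plus; simpl; ring.
    - apply @ex_series_plus; [|easy]. eexists; now apply Hg. }
  assert (Hex : forall x, 1 / 2 <= x -> ex_series (u x)).
  { intros x Hx. apply Hstep; [lra|]. apply Hstep; [lra|]. apply Hex2; lra. }
  assert (Hrec : forall x, 1 / 2 <= x -> g x = Series (u x) - Series (u (x + 1))).
  { intros x Hx. rewrite <- Series_minus by (apply Hex; lra).
    symmetry; apply is_series_unique. now apply Hg. }
  split; [apply Series_correct; now apply Hex|].
  apply is_series_ext with
    (fun k => Series (u (a + INR k)) - Series (u (a + INR (S k)))).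
  { intros k. rewrite Hrec by (pose proof (pos_INR k); lra).
    now rewrite S_INR, Rplus_assoc. }
  replace (Series (u a)) with (Series (u (a + INR 0)))
    by (now rewrite Rplus_0_r).
  apply (is_series_telescope (fun k => Series (u (a + INR k)))).
  (* Dropping two terms brings the parameter a + k + 2 into the range of the majorant. *)
  apply is_lim_seq_incr_n with (N := 2%nat).
  apply is_lim_seq_le_le with
    (u := fun _ => 0) (w := fun k => 2 * / (INR k + 1)).
  - intros k. pose proof (pos_INR k).
    assert (INR (k + 2) = INR k + 2) as E by (rewrite plus_INR; simpl; ring).
    rewrite E.
    assert (Hx : 2 <= a + (INR k + 2)) by lra.
    split.
    + replace 0 with (Series (fun j => 0 * u (a + (INR k + 2)) j))
        by (rewrite Series_scal_l; ring).
      apply Series_le; [|now apply Hex2].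
      intros j. pose proof (proj1 (Hu _ j Hx)). lra.
    + apply Rle_trans with (2 / (a + (INR k + 2))).
      * rewrite <- (is_series_unique _ _ (Hbd _ Hx)).
        apply Series_le; [intros j; now apply Hu|]. eexists; now apply Hbd.
      * apply Rmult_le_compat_l; [lra|]. apply Rinv_le_contravar; lra.
  - apply is_lim_seq_const.
  - replace (Finite 0) with (Rbar_mult 2 0) by (simpl; now rewrite Rmult_0_r).
    apply is_lim_seq_scal_l. apply inv_add_lim.
Qed.

(** Equality holds at a = 2. For a >= 2 the step factor (k+1)/(a+k+1) is at most its value
    (k+1)/(k+3) at a = 2, and the initial values 1/a agree. *)
Lemma beta_le (a : R) (k : nat) :
  2 <= a -> beta a k <= 2 / a * / ((INR k + 1) * (INR k + 2)).
Proof.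
  intros Ha; induction k as [|k IH]; cbn [beta].
  - simpl; right; field; lra.
  - pose proof (pos_INR k). rewrite S_INR.
    apply Rle_trans with
      (2 / a * / ((INR k + 1) * (INR k + 2)) * ((INR k + 1) / (INR k + 3))).
    + unfold Rdiv at 1. rewrite Rmult_assoc.
      apply Rmult_le_compat; [left; apply beta_pos; lra| |easy|].
      * left; apply Rdiv_lt_0_compat; lra.
      * apply Rmult_le_compat_l; [lra|]. apply Rinv_le_contravar; lra.
    + right; field; lra.
Qed.

Lemma harm_le (a : R) (k : nat) : 0 < a -> harm a k <= (INR k + 1) / a.
Proof.
  intros Ha; induction k as [|k IH]; cbn [harm].
  - simpl; right; field; lra.
  - pose proof (pos_INR k). rewrite S_INR.
    assert (/ (a + INR k + 1) <= / a) by (apply Rinv_le_contravar; lra).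
    unfold Rdiv in *; lra.
Qed.

(** The shift x -> x + 1 lowers the k-th term by [(beta x k - beta x (S k)) / x], and these
    differences telescope to 1/x^2. The common sum stays existential here; it is identified with
    zeta values later. *)
Lemma is_series_beta (a : R) :
  1 / 2 <= a ->
  exists l : R,
    is_series (fun k => beta a k / (INR k + 1)) l /\
    is_series (fun k => / (a + INR k) ^ 2) l.
Proof.
  intros Ha. eexists.
  apply (is_series_shift (fun x k => beta x k / (INR k + 1)) (fun x => / x ^ 2));
    [| |easy].
  - intros x Hx.
    apply is_series_ext with (fun k => scal (/ x) (beta x k - beta x (S k))).
    + intros k. rewrite beta_shift by lra. cbn [beta].
      pose proof (pos_INR k). unfold scal; simpl; unfold mult; simpl.
      field; lra.
    + replace (/ x ^ 2) with (scal (/ x) (beta x 0))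
        by (unfold scal; simpl; unfold mult; simpl; field; lra).
      apply @is_series_scal. apply is_series_telescope. now apply beta_lim.
  - intros x k Hx. pose proof (pos_INR k).
    pose proof (beta_pos x k ltac:(lra)). pose proof (beta_le x k Hx).
    split; [left; apply Rdiv_lt_0_compat; lra|].
    apply Rle_div_l; [lra|]. nra.
Qed.

(* Minus the derivative in [a] of [is_series_beta]. *)
Lemma is_series_beta_harm (a : R) :
  1 / 2 <= a ->
  exists l : R,
    is_series (fun k => beta a k * harm a k / (INR k + 1)) l /\
    is_series (fun k => 2 / (a + INR k) ^ 3) l.
Proof.
  intros Ha. eexists.
  apply (is_series_shift (fun x k => beta x k * harm x k / (INR k + 1))
           (fun x => 2 / x ^ 3)); [| |easy].
  - intros x Hx.
    (* Minus the derivative in x of [beta x k / x], the sequence that telescopes in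
       [is_series_beta]. *)
    set (v := fun k => / x ^ 2 * beta x k + / x * (beta x k * harm x k)).
    apply is_series_ext with (fun k => v k - v (S k)).
    + intros k. rewrite beta_shift, harm_shift by lra.
      unfold v. cbn [beta harm].
      pose proof (pos_INR k). refine (_ : @eq R _ _). field; lra.
    + replace (2 / x ^ 3) with (v O) by (unfold v; simpl; field; lra).
      apply is_series_telescope. unfold v.
      replace (Finite 0) with (Finite (/ x ^ 2 * 0 + / x * 0)) by (f_equal; ring).
      apply is_lim_seq_plus'.
      * apply (is_lim_seq_scal_l _ (/ x ^ 2) 0). now apply beta_lim.
      * apply (is_lim_seq_scal_l _ (/ x) 0). now apply beta_harm_lim.
  - intros x k Hx. pose proof (pos_INR k).
    pose proof (beta_pos x k ltac:(lra)). pose proof (beta_le x k Hx).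
    pose proof (harm_pos x k ltac:(lra)). pose proof (harm_le x k ltac:(lra)).
    split.
    + left; apply Rdiv_lt_0_compat; [apply Rmult_lt_0_compat|]; lra.
    + apply Rle_div_l; [lra|].
      apply Rmult_le_compat; try lra.
      apply Rle_trans with (1 := H3).
      apply Rle_div_l; [lra|]. nra.
Qed.

(** * Gosper reduction of the sums with denominator (k+2)(k+3)(k+4) *)

(** The partial-fraction shape of the certificates [v] and [dv] below; boundedness makes their
    products with [beta] vanish at infinity. *)
Lemma rational_lim (c0 c1 c2 c3 : R) :
  is_lim_seq (fun k => c0 + c1 * / (INR k + 1) + c2 * / (INR k + 2)
                          + c3 * / (INR k + 3)) c0.
Proof.
  replace (Finite c0) with (Finite (c0 + c1 * 0 + c2 * 0 + c3 * 0))
    by (f_equal; ring).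
  repeat apply is_lim_seq_plus'; [apply is_lim_seq_const|..].
  - apply (is_lim_seq_scal_l _ c1 0), inv_add_lim.
  - apply (is_lim_seq_scal_l _ c2 0), inv_add_lim.
  - apply (is_lim_seq_scal_l _ c3 0), inv_add_lim.
Qed.

(* Gosper's algorithm gives [beta a k / ((k+2) (k+3) (k+4)) =
   - (a-1) a (a+1) / 12 * beta a k / (k+1) + (v (k+1) * beta a (k+1) - v k * beta a k)]
   for the rational function [v k] below. *)
Lemma is_series_beta_div3 (a l : R) :
  1 / 2 <= a ->
  is_series (fun k => beta a k / (INR k + 1)) l ->
  is_series (fun k => beta a k / ((INR k + 2) * (INR k + 3) * (INR k + 4)))
    (- ((a - 1) * a * (a + 1) / 12) * l + (6 * a ^ 2 + 3 * a - 5) / 72).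
Proof.
  intros Ha Hl.
  set (v := fun k => (1 - a ^ 2) / 12
    + - (a * (a + 1) * (a - 1) / 12) * / (INR k + 1)
    + (a + 3) * (a - 2) / 12 * / (INR k + 2) + - ((a - 3) / 6) * / (INR k + 3)).
  assert (Hv : is_lim_seq (fun k => v k * beta a k) 0).
  { replace (Finite 0) with (Finite ((1 - a ^ 2) / 12 * 0)) by (f_equal; ring).
    apply is_lim_seq_mult'; [apply rational_lim | now apply beta_lim]. }
  pose proof (is_series_plus _ _ _ _
    (is_series_scal_l (- ((a - 1) * a * (a + 1) / 12)) _ _ Hl)
    (* The reduction contains v (k+1) beta (k+1) - v k beta k, the opposite of what
       [is_series_telescope] sums. *)
    (is_series_scal_l (-1) _ _ (is_series_telescope _ Hv))) as H.
  unfold plus, scal in H; simpl in H; unfold mult in H; simpl in H.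
  match type of H with is_series _ ?x =>
    replace (- ((a - 1) * a * (a + 1) / 12) * l + (6 * a ^ 2 + 3 * a - 5) / 72)
      with x by (unfold v; simpl; field; lra) end.
  apply is_series_ext with (2 := H).
  intros k. unfold v. rewrite S_INR. cbn [beta]. pose proof (pos_INR k).
  refine (_ : @eq R _ _). field; lra.
Qed.

(* Minus the derivative in [a] of [is_series_beta_div3]. *)
Lemma is_series_beta_harm_div3 (a l l' : R) :
  1 / 2 <= a ->
  is_series (fun k => beta a k / (INR k + 1)) l ->
  is_series (fun k => beta a k * harm a k / (INR k + 1)) l' ->
  is_series
    (fun k => beta a k * harm a k / ((INR k + 2) * (INR k + 3) * (INR k + 4)))
    ((3 * a ^ 2 - 1) / 12 * l - (a - 1) * a * (a + 1) / 12 * l'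
     - (4 * a + 1) / 24).
Proof.
  intros Ha Hl Hl'.
  set (v := fun k => (1 - a ^ 2) / 12
    + - (a * (a + 1) * (a - 1) / 12) * / (INR k + 1)
    + (a + 3) * (a - 2) / 12 * / (INR k + 2) + - ((a - 3) / 6) * / (INR k + 3)).
  (* The derivative of [v] in [a]. Hence [dv k * beta a k - v k * (beta a k * harm a k)] is the
     derivative of [v k * beta a k]; the minus sign of the differentiation now gives the telescoping
     its usual direction. *)
  set (dv := fun k => - a / 6 + - ((3 * a ^ 2 - 1) / 12) * / (INR k + 1)
    + (2 * a + 1) / 12 * / (INR k + 2) + - (1 / 6) * / (INR k + 3)).
  assert (Hv : is_lim_seq
    (fun k => dv k * beta a k - v k * (beta a k * harm a k)) 0).
  { replace (Finite 0) with (Finite (- a / 6 * 0 - (1 - a ^ 2) / 12 * 0))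
      by (f_equal; ring).
    apply is_lim_seq_minus'; apply is_lim_seq_mult'; try apply rational_lim.
    - now apply beta_lim.
    - now apply beta_harm_lim. }
  pose proof (is_series_plus _ _ _ _
    (is_series_plus _ _ _ _
      (is_series_scal_l ((3 * a ^ 2 - 1) / 12) _ _ Hl)
      (is_series_scal_l (- ((a - 1) * a * (a + 1) / 12)) _ _ Hl'))
    (is_series_telescope _ Hv)) as H.
  unfold plus, scal in H; simpl in H; unfold mult in H; simpl in H.
  match type of H with is_series _ ?x =>
    replace ((3 * a ^ 2 - 1) / 12 * l - (a - 1) * a * (a + 1) / 12 * l'
             - (4 * a + 1) / 24)
      with x by (unfold v, dv; simpl; field; lra) end.
  apply is_series_ext with (2 := H).
  intros k. unfold v, dv. rewrite S_INR. cbn [beta harm]. pose proof (pos_INR k).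
  refine (_ : @eq R _ _). field; lra.
Qed.

(** * The sum of 1/(k+1/2)^2 from finite sums of 1/sin^2 *)

(** The function sin t - t cos t vanishes at 0 and has derivative t sin t >= 0. *)
Lemma x_cos_le_sin (x : R) : 0 <= x <= PI / 2 -> x * cos x <= sin x.
Proof.
  intros Hx. pose proof PI_RGT_0.
  destruct (MVT_gen (fun t => sin t - t * cos t) 0 x (fun t => t * sin t))
    as [c [Hc Heq]].
  - intros t _. auto_derive; [easy | ring].
  - intros t _. reg.
  - rewrite Rmin_left, Rmax_right in Hc by lra.
    assert (0 <= sin c) by (apply sin_ge_0; lra).
    rewrite sin_0 in Heq.
    assert (0 <= c * sin c * (x - 0)) by (repeat apply Rmult_le_pos; lra).
    lra.
Qed.

(** These are the squares of cot x <= 1/x <= 1/sin x, as cot^2 x = 1/sin^2 x - 1. *)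
Lemma inv_sin_sqr_bounds (x : R) :
  0 < x < PI / 2 -> / sin x ^ 2 - 1 <= / x ^ 2 <= / sin x ^ 2.
Proof.
  intros Hx. pose proof PI_RGT_0.
  assert (Hs : 0 < sin x) by (apply sin_gt_0; lra).
  assert (Hc : 0 < cos x) by (apply cos_gt_0; lra).
  pose proof (sin_lt_x x ltac:(lra)).
  pose proof (x_cos_le_sin x ltac:(lra)).
  pose proof (sin2_cos2 x) as E. unfold Rsqr in E.
  split.
  - apply Rmult_le_reg_r with (sin x ^ 2 * x ^ 2).
    { apply Rmult_lt_0_compat; apply pow_lt; lra. }
    replace ((/ sin x ^ 2 - 1) * (sin x ^ 2 * x ^ 2)) with
      ((1 - sin x * sin x) * x ^ 2) by (field; lra).
    replace (/ x ^ 2 * (sin x ^ 2 * x ^ 2)) with (sin x ^ 2) by (field; lra).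
    replace (1 - sin x * sin x) with (cos x * cos x) by lra.
    assert (0 <= x * cos x) by (apply Rmult_le_pos; lra). nra.
  - apply Rinv_le_contravar; [apply pow_lt; lra|]. nra.
Qed.

(** For y = x/2, sin x = 2 sin y cos y and 1/(sin^2 y cos^2 y) = 1/sin^2 y + 1/cos^2 y. *)
Lemma inv_sin_sqr_half (x : R) :
  0 < x < PI ->
  / sin x ^ 2 = / 4 * (/ sin (x / 2) ^ 2 + / sin (PI / 2 - x / 2) ^ 2).
Proof.
  intros Hx.
  assert (0 < sin (x / 2)) by (apply sin_gt_0; lra).
  assert (0 < cos (x / 2)) by (apply cos_gt_0; lra).
  rewrite sin_shift. replace x with (2 * (x / 2)) at 1 by field.
  rewrite sin_2a.
  pose proof (sin2_cos2 (x / 2)) as E. unfold Rsqr in E.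
  transitivity ((sin (x / 2) * sin (x / 2) + cos (x / 2) * cos (x / 2)) *
                / (2 * sin (x / 2) * cos (x / 2)) ^ 2).
  - rewrite E; ring.
  - field; lra.
Qed.

Lemma sum_f_R0_rev (g : nat -> R) (n : nat) :
  sum_f_R0 (fun k => g (n - k)%nat) n = sum_f_R0 g n.
Proof.
  induction n as [|n IH]; [easy|].
  rewrite decomp_sum by lia. rewrite Nat.sub_0_r. cbn [pred].
  rewrite (sum_eq _ (fun k => g (n - k)%nat)) by (intros; f_equal; lia).
  rewrite IH. simpl. ring.
Qed.

(** The pairing of k with 2n+1-k matches the two angles x/2 and pi/2 - x/2 of [inv_sin_sqr_half]. *)
Lemma sum_f_R0_fold (g : nat -> R) (n : nat) :
  sum_f_R0 g (2 * n + 1) = sum_f_R0 (fun k => g k + g (2 * n + 1 - k)%nat) n.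
Proof.
  rewrite (tech2 g n) by lia. rewrite sum_plus. f_equal.
  replace (2 * n + 1 - S n)%nat with n by lia.
  rewrite <- sum_f_R0_rev. apply sum_eq. intros i Hi. f_equal. lia.
Qed.

(** For k <= n these are the odd multiples of pi/(4N) in (0, pi/2), where N = n + 1. Their halves,
    together with the complements of these halves, are the angles for 2N. *)
Definition odd_angle (n k : nat) : R := (2 * INR k + 1) * PI / (4 * (INR n + 1)).

Lemma odd_angle_bounds (n k : nat) :
  (k <= n)%nat -> 0 < odd_angle n k < PI / 2.
Proof.
  intros Hk. apply le_INR in Hk. pose proof PI_RGT_0.
  pose proof (pos_INR k). unfold odd_angle. split.
  - apply Rdiv_lt_0_compat; [apply Rmult_lt_0_compat|]; lra.
  - apply Rlt_div_l; nra.
Qed.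

Lemma sum_inv_sin_sqr_step (n : nat) :
  sum_f_R0 (fun k => / sin (odd_angle (2 * n + 1) k) ^ 2) (2 * n + 1) =
  4 * sum_f_R0 (fun k => / sin (odd_angle n k) ^ 2) n.
Proof.
  rewrite sum_f_R0_fold, scal_sum. apply sum_eq. intros k Hk.
  pose proof (odd_angle_bounds n k Hk). pose proof PI_RGT_0.
  rewrite (inv_sin_sqr_half (odd_angle n k)) by lra.
  assert (Hn : 0 <= INR n) by apply pos_INR.
  replace (odd_angle (2 * n + 1) k) with (odd_angle n k / 2)
    by (unfold odd_angle; rewrite plus_INR, mult_INR; simpl; field; lra).
  replace (odd_angle (2 * n + 1) (2 * n + 1 - k)) with
    (PI / 2 - odd_angle n k / 2); [field; split|].
  - apply Rgt_not_eq, sin_gt_0; lra.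
  - apply Rgt_not_eq, sin_gt_0; lra.
  - unfold odd_angle. rewrite minus_INR, plus_INR, mult_INR by lia.
    simpl. field; lra.
Qed.

(** Here n + 1 = 2^j doubles at each step while the sum gains a factor 4. The start is the single
    angle pi/4, where 1/sin^2 is 2. *)
Lemma sum_inv_sin_sqr (j : nat) :
  let n := (2 ^ j - 1)%nat in
  sum_f_R0 (fun k => / sin (odd_angle n k) ^ 2) n = 2 * (INR n + 1) ^ 2.
Proof.
  cbv zeta. induction j as [|j IH].
  - simpl. unfold odd_angle. simpl.
    replace ((2 * 0 + 1) * PI / (4 * (0 + 1))) with (PI / 4) by field.
    rewrite sin_PI4. pose proof (sqrt_lt_R0 2 ltac:(lra)).
    pose proof (sqrt_sqrt 2 ltac:(lra)) as E.
    replace (1 / sqrt 2 * (1 / sqrt 2 * 1)) with (/ (sqrt 2 * sqrt 2))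
      by (field; lra).
    rewrite E. field.
  - assert (1 <= 2 ^ j)%nat by (apply Nat.neq_0_lt_0, Nat.pow_nonzero; lia).
    replace (2 ^ S j - 1)%nat with (2 * (2 ^ j - 1) + 1)%nat by (simpl; lia).
    rewrite sum_inv_sin_sqr_step, IH, plus_INR, mult_INR. simpl. ring.
Qed.

(** Convergence is given, so the partial sums with N = 2^j terms determine l. Such a sum is
    pi^2/(4N^2) times the sum of 1/x^2 over the odd angles x, which lies between 2N^2 - N and
    2N^2. *)
Lemma is_series_inv_half_sqr (l : R) :
  is_series (fun k => / (1 / 2 + INR k) ^ 2) l -> l = PI ^ 2 / 2.
Proof.
  intros Hl. pose proof PI_RGT_0.
  set (n := fun j => (2 ^ j - 1)%nat).
  assert (Hn : forall j, (n j < n (S j))%nat).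
  { intros j. unfold n.
    assert (1 <= 2 ^ j)%nat by (apply Nat.neq_0_lt_0, Nat.pow_nonzero; lia).
    simpl; lia. }
  assert (Hsub := is_lim_seq_subseq
    (sum_n (fun k => / (1 / 2 + INR k) ^ 2)) l _ (eventually_subseq n Hn) Hl).
  assert (Hsum : forall j,
    sum_n (fun k => / (1 / 2 + INR k) ^ 2) (n j) =
    PI ^ 2 / 4 / (INR (n j) + 1) ^ 2 *
      sum_f_R0 (fun k => / odd_angle (n j) k ^ 2) (n j)).
  { intros j. rewrite sum_n_Reals, scal_sum. apply sum_eq. intros k _.
    unfold odd_angle. pose proof (pos_INR k). pose proof (pos_INR (n j)).
    field; repeat split; lra. }
  assert (Hlim : is_lim_seq
    (fun j => sum_n (fun k => / (1 / 2 + INR k) ^ 2) (n j)) (PI ^ 2 / 2)).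
  { apply is_lim_seq_le_le with
      (u := fun j => PI ^ 2 / 2 - PI ^ 2 / 4 * / (INR (n j) + 1))
      (w := fun _ => PI ^ 2 / 2).
    - intros j. rewrite Hsum. pose proof (sum_inv_sin_sqr j) as E.
      cbv zeta in E. fold (n j) in E. pose proof (pos_INR (n j)).
      assert (0 < PI ^ 2 / 4 / (INR (n j) + 1) ^ 2)
        by (repeat apply Rdiv_lt_0_compat; try apply pow_lt; lra).
      split.
      + replace (PI ^ 2 / 2 - PI ^ 2 / 4 * / (INR (n j) + 1)) with
          (PI ^ 2 / 4 / (INR (n j) + 1) ^ 2 *
           sum_f_R0 (fun k => / sin (odd_angle (n j) k) ^ 2 - 1) (n j)).
        * apply Rmult_le_compat_l; [lra|]. apply sum_Rle. intros k Hk.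
          now apply inv_sin_sqr_bounds, odd_angle_bounds.
        * rewrite minus_sum, E, sum_cte, S_INR. field; lra.
      + replace (PI ^ 2 / 2) with
          (PI ^ 2 / 4 / (INR (n j) + 1) ^ 2 *
           sum_f_R0 (fun k => / sin (odd_angle (n j) k) ^ 2) (n j)).
        * apply Rmult_le_compat_l; [lra|]. apply sum_Rle. intros k Hk.
          now apply inv_sin_sqr_bounds, odd_angle_bounds.
        * rewrite E. field; lra.
    - replace (Finite (PI ^ 2 / 2)) with
        (Finite (PI ^ 2 / 2 - PI ^ 2 / 4 * 0)) by (f_equal; ring).
      apply is_lim_seq_minus'; [apply is_lim_seq_const|].
      apply (is_lim_seq_scal_l _ (PI ^ 2 / 4) 0).
      apply (is_lim_seq_subseq (fun k => / (INR k + 1)) 0 n);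
        [now apply eventually_subseq | apply inv_add_lim].
    - apply is_lim_seq_const. }
  apply is_lim_seq_unique in Hsub. apply is_lim_seq_unique in Hlim.
  rewrite Hlim in Hsub. now injection Hsub.
Qed.

(** * Zeta values, odd harmonic numbers and tails *)

Lemma zeta_INR (s : nat) :
  zeta (INR s) = Series (fun k => / (1 + INR k) ^ s).
Proof.
  apply Series_ext. intros k.
  rewrite Rpower_pow by (apply lt_0_INR; lia). now rewrite S_INR, Rplus_comm.
Qed.

(** Splitting the first 2n+2 terms of the second series by parity gives z = 2^(-s) (l + z) in the
    limit. *)
Lemma is_series_inv_half_pow (s : nat) (l z : R) :
  is_series (fun k => / (1 / 2 + INR k) ^ s) l ->
  is_series (fun k => / (1 + INR k) ^ s) z ->
  l = (2 ^ s - 1) * z.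
Proof.
  intros Hl Hz.
  assert (H2 : 2 ^ s <> 0) by (apply pow_nonzero; lra).
  assert (Hsum : forall n,
    sum_n (fun k => / (1 + INR k) ^ s) (2 * n + 1) =
    / 2 ^ s * (sum_n (fun k => / (1 / 2 + INR k) ^ s) n
               + sum_n (fun k => / (1 + INR k) ^ s) n)).
  { assert (Hodd : forall n, / (1 + INR (2 * n)) ^ s =
                             / 2 ^ s * / (1 / 2 + INR n) ^ s).
    { intros n. rewrite <- Rinv_mult, <- Rpow_mult_distr, mult_INR.
      do 2 f_equal. simpl; field. }
    assert (Heven : forall n, / (1 + INR (S (2 * n))) ^ s =
                              / 2 ^ s * / (1 + INR n) ^ s).
    { intros n. rewrite <- Rinv_mult, <- Rpow_mult_distr, S_INR, mult_INR.
      do 2 f_equal. simpl; field. }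
    induction n as [|n IH].
    - replace (2 * 0 + 1)%nat with (S (2 * 0)) by lia.
      rewrite sum_Sn, Heven. replace (2 * 0)%nat with 0%nat by lia.
      rewrite !sum_O.
      pose proof (Hodd 0%nat) as H0. simpl (2 * 0)%nat in H0. rewrite H0.
      unfold plus; simpl. ring.
    - replace (2 * S n + 1)%nat with (S (S (2 * n + 1))) by lia.
      rewrite !sum_Sn, IH.
      replace (S (S (2 * n + 1))) with (S (2 * S n)) by lia.
      replace (S (2 * n + 1)) with (2 * S n)%nat by lia.
      rewrite Hodd, Heven. unfold plus; simpl. ring. }
  assert (Hsub : is_lim_seq
    (fun n => sum_n (fun k => / (1 + INR k) ^ s) (2 * n + 1)) z).
  { apply (is_lim_seq_subseq (sum_n (fun k => / (1 + INR k) ^ s)) z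
             (fun n => 2 * n + 1)%nat); [|exact Hz].
    apply eventually_subseq. intros n; lia. }
  assert (Hlim : is_lim_seq
    (fun n => sum_n (fun k => / (1 + INR k) ^ s) (2 * n + 1))
    (/ 2 ^ s * (l + z))).
  { apply is_lim_seq_ext with (1 := fun n => eq_sym (Hsum n)).
    apply (is_lim_seq_scal_l _ (/ 2 ^ s) (l + z)).
    now apply is_lim_seq_plus'. }
  apply is_lim_seq_unique in Hsub. apply is_lim_seq_unique in Hlim.
  rewrite Hlim in Hsub. injection Hsub as E.
  assert (l + z = 2 ^ s * z).
  { apply Rmult_eq_reg_l with (/ 2 ^ s); [|now apply Rinv_neq_0_compat].
    rewrite E. field; easy. }
  lra.
Qed.

Lemma odd_harmonic_S (r m : nat) :
  odd_harmonic r (S m) = odd_harmonic r m + / (2 * INR m + 1) ^ r.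
Proof.
  unfold odd_harmonic. rewrite sum_n_Sm by lia.
  now replace (2 * INR m + 1) with (2 * INR (S m) - 1) by (rewrite S_INR; ring).
Qed.

Lemma odd_harmonic_0 (r : nat) : odd_harmonic r 0 = 0.
Proof. unfold odd_harmonic. now rewrite sum_n_m_zero by lia. Qed.

(** The terms beyond the m-th are 1/(2(m+j)+1) = (1/2)/(m+1/2+j) for j = 0, ..., k. *)
Lemma odd_harmonic_add (m k : nat) :
  odd_harmonic 1 (S k + m) =
  odd_harmonic 1 m + / 2 * harm (INR m + 1 / 2) k.
Proof.
  pose proof (pos_INR m).
  induction k as [|k IH].
  - change (1 + m)%nat with (S m). rewrite odd_harmonic_S. simpl. field; lra.
  - change (S (S k) + m)%nat with (S (S k + m)).
    rewrite odd_harmonic_S, IH, plus_INR, S_INR. cbn [harm].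
    pose proof (pos_INR k). simpl. field; lra.
Qed.

(** The m terms removed are 2^r/(2j-1)^r for j = 1, ..., m. *)
Lemma is_series_odd_tail (r m : nat) (l : R) :
  is_series (fun k => / (1 / 2 + INR k) ^ r) l ->
  is_series (fun k => / (INR m + 1 / 2 + INR k) ^ r)
    (l - 2 ^ r * odd_harmonic r m).
Proof.
  intros Hl. induction m as [|m IH].
  - rewrite odd_harmonic_0, Rmult_0_r, Rminus_0_r.
    apply is_series_ext with (2 := Hl). intros k. simpl INR.
    now rewrite Rplus_0_l.
  - apply is_series_ext with (fun k => / (INR m + 1 / 2 + INR (S k)) ^ r).
    { intros k. rewrite !S_INR. do 2 f_equal. ring. }
    apply (is_series_incr_1 (fun k => / (INR m + 1 / 2 + INR k) ^ r)).
    match goal with |- is_series _ ?y =>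
      replace y with (l - 2 ^ r * odd_harmonic r m); [exact IH|] end.
    unfold plus; simpl. pose proof (pos_INR m).
    rewrite odd_harmonic_S, Rplus_0_r.
    replace (2 * INR m + 1) with (2 * (INR m + 1 / 2)) by field.
    rewrite Rpow_mult_distr. field. split; apply pow_nonzero; lra.
Qed.

(** [is_series_beta] supplies convergence at a = 1/2 and a = 1; the parity relation gives the factor
    2^2 - 1. *)
Lemma is_series_inv_half_pow2 :
  is_series (fun k => / (1 / 2 + INR k) ^ 2) (3 * zeta 2).
Proof.
  destruct (is_series_beta (1 / 2) ltac:(lra)) as [l [_ Hl]].
  destruct (is_series_beta 1 ltac:(lra)) as [z [_ Hz]].
  replace (3 * zeta 2) with l; [exact Hl|].
  rewrite (is_series_inv_half_pow 2 l z Hl Hz).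
  change (zeta 2) with (zeta (INR 2)).
  rewrite zeta_INR, (is_series_unique _ _ Hz). ring.
Qed.

Lemma is_series_inv_half_pow3 :
  is_series (fun k => / (1 / 2 + INR k) ^ 3) (7 * zeta 3).
Proof.
  assert (Hex : forall a, 1 / 2 <= a -> exists l : R,
                  is_series (fun k => / (a + INR k) ^ 3) l).
  { intros a Ha. destruct (is_series_beta_harm a Ha) as [l [_ Hl]].
    exists (/ 2 * l).
    apply is_series_ext with (fun k => / 2 * (2 / (a + INR k) ^ 3));
      [|exact (is_series_scal_l (/ 2) _ _ Hl)].
    intros k. pose proof (pos_INR k). refine (_ : @eq R _ _). field; lra. }
  destruct (Hex (1 / 2) ltac:(lra)) as [l Hl].
  destruct (Hex 1 ltac:(lra)) as [z Hz].
  replace (7 * zeta 3) with l; [exact Hl|].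
  rewrite (is_series_inv_half_pow 3 l z Hl Hz).
  replace (zeta 3) with (zeta (INR 3)) by (now rewrite INR_IZR_INZ).
  rewrite zeta_INR, (is_series_unique _ _ Hz). ring.
Qed.

Lemma zeta_2 : zeta 2 = PI ^ 2 / 6.
Proof.
  pose proof (is_series_inv_half_sqr _ is_series_inv_half_pow2). lra.
Qed.

(** * Binomial coefficients and the summand in terms of [beta] *)

Lemma central_binom_pos (n : nat) : 0 < central_binom n.
Proof.
  unfold central_binom, Binomial.C. pose proof INR_fact_lt_0.
  apply Rdiv_lt_0_compat; [|apply Rmult_lt_0_compat]; easy.
Qed.

Lemma central_binom_S (n : nat) :
  central_binom (S n) = central_binom n * (2 * (2 * INR n + 1)) / (INR n + 1).
Proof.
  unfold central_binom, Binomial.C.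
  replace (2 * S n)%nat with (S (S (2 * n))) by lia.
  replace (S (S (2 * n)) - S n)%nat with (S n) by lia.
  replace (2 * n - n)%nat with n by lia.
  rewrite !fact_simpl, !mult_INR, !S_INR, mult_INR.
  pose proof (INR_fact_lt_0 n). pose proof (pos_INR n). simpl. field; lra.
Qed.

Lemma binom_add_S (n m : nat) :
  Binomial.C (S n + m) m =
  Binomial.C (n + m) m * (INR n + INR m + 1) / (INR n + 1).
Proof.
  unfold Binomial.C.
  replace (S n + m - m)%nat with (S n) by lia.
  replace (n + m - m)%nat with n by lia.
  change (S n + m)%nat with (S (n + m)).
  rewrite !fact_simpl, !mult_INR, !S_INR, plus_INR.
  pose proof (INR_fact_lt_0 n). pose proof (INR_fact_lt_0 m).
  pose proof (pos_INR n). field; lra.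
Qed.

Lemma binom_add_pos (n m : nat) : 0 < Binomial.C (n + m) m.
Proof.
  unfold Binomial.C. pose proof INR_fact_lt_0.
  apply Rdiv_lt_0_compat; [|apply Rmult_lt_0_compat]; easy.
Qed.

(** Passing from n to n+1 multiplies 4^n by 4, the central binomial by 2(2(n+m)+1)/(n+m+1) and the
    other binomial by (n+m+1)/(n+1). The quotient thus gains (n+1)/(n+m+1/2), starting at n = 0 from
    1/binom(2m, m). *)
Lemma pow4_div_binom (m k : nat) :
  2 ^ (2 * S k) / (central_binom (S k + m) * Binomial.C (S k + m) m) =
  (INR k + 1) * beta (INR m + 1 / 2) k / central_binom m.
Proof.
  assert (Hstep : forall n,
    2 ^ (2 * S n) / (central_binom (S n + m) * Binomial.C (S n + m) m) =
    2 ^ (2 * n) / (central_binom (n + m) * Binomial.C (n + m) m) *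
    ((INR n + 1) / (INR n + INR m + 1 / 2))).
  { intros n. rewrite binom_add_S. change (S n + m)%nat with (S (n + m)).
    rewrite central_binom_S, plus_INR.
    replace (2 * S n)%nat with (2 + 2 * n)%nat by lia. rewrite pow_add.
    pose proof (central_binom_pos (n + m)). pose proof (binom_add_pos n m).
    pose proof (pos_INR n). pose proof (pos_INR m). field; lra. }
  pose proof (pos_INR m). pose proof (central_binom_pos m).
  induction k as [|k IH]; rewrite Hstep.
  (* Symmetry turns binom(m, m) into binom(m, 0). *)
  - rewrite Nat.add_0_l, pascal_step1 by lia. rewrite Nat.sub_diag.
    unfold Binomial.C at 1.
    rewrite Nat.sub_0_r. pose proof (INR_fact_lt_0 m). simpl. field; lra.
  - rewrite IH, S_INR. cbn [beta]. pose proof (pos_INR k). field; lra.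
Qed.

(** * The sum for general m and its special cases *)

Lemma is_series_central_binom (m : nat) :
  is_series_from1
    (fun n : nat =>
       2 ^ (2 * n) * odd_harmonic 1 (n + m) /
       (INR n * (INR n + 1) * (INR n + 2) * (INR n + 3) *
        central_binom (n + m) * Binomial.C (n + m) m))
    (1 / (2 * central_binom m) *
       (1 / 6 * (INR m - 1 / 2) * (INR m + 1 / 2) * (INR m + 3 / 2)
          * odd_harmonic 1 m
        - INR m ^ 2 / 4 - INR m / 4 + 1 / 48) *
       (4 * odd_harmonic 2 m - 3 * zeta 2)
     + 1 / (12 * central_binom m) *
       (INR m - 1 / 2) * (INR m + 1 / 2) * (INR m + 3 / 2) *
       (8 * odd_harmonic 3 m - 7 * zeta 3)
     + 1 / (2 * central_binom m) *
       (1 / 36 * (6 * INR m ^ 2 + 9 * INR m - 2) * odd_harmonic 1 m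
        - INR m / 6 - 1 / 8)).
Proof.
  pose proof (pos_INR m) as Hm. pose proof (central_binom_pos m) as Hc.
  set (a := INR m + 1 / 2).
  assert (Ha : 1 / 2 <= a) by (unfold a; lra).
  destruct (is_series_beta a Ha) as [l [Hf Hl]].
  destruct (is_series_beta_harm a Ha) as [l' [Hfh Hl']].
  assert (El : l = 3 * zeta 2 - 4 * odd_harmonic 2 m).
  { rewrite <- (is_series_unique _ _ Hl).
    replace (4 * odd_harmonic 2 m) with (2 ^ 2 * odd_harmonic 2 m) by ring.
    apply is_series_unique.
    exact (is_series_odd_tail 2 m _ is_series_inv_half_pow2). }
  assert (El' : l' = 14 * zeta 3 - 16 * odd_harmonic 3 m).
  { rewrite <- (is_series_unique _ _ Hl').
    replace (14 * zeta 3 - 16 * odd_harmonic 3 m) with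
      (2 * (7 * zeta 3 - 2 ^ 3 * odd_harmonic 3 m)) by ring.
    apply is_series_unique.
    exact (is_series_scal_l 2 _ _
      (is_series_odd_tail 3 m _ is_series_inv_half_pow3)). }
  pose proof (is_series_scal_l (/ central_binom m) _ _
    (is_series_plus _ _ _ _
      (is_series_scal_l (odd_harmonic 1 m) _ _ (is_series_beta_div3 a l Ha Hf))
      (is_series_scal_l (/ 2) _ _ (is_series_beta_harm_div3 a l l' Ha Hf Hfh))))
    as H.
  unfold plus, scal in H; simpl in H; unfold mult in H; simpl in H.
  match type of H with is_series _ ?x =>
    match goal with |- is_series_from1 _ ?y => replace y with x end end.
  (* At a = m + 1/2 the product (a-1) a (a+1) becomes (m-1/2)(m+1/2)(m+3/2). *)
  2: { rewrite El, El'. unfold a. field; lra. }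
  apply is_series_ext with (2 := H).
  intros k. refine (_ : @eq R _ _).
  rewrite odd_harmonic_add, !S_INR. fold a.
  (* Here n = k + 1, so the factor k + 1 in [pow4_div_binom] cancels n and leaves the denominator
     (k+2)(k+3)(k+4). *)
  pose proof (pow4_div_binom m k) as E. fold a in E.
  pose proof (pos_INR k) as Hk.
  pose proof (central_binom_pos (S k + m)). pose proof (binom_add_pos (S k) m).
  replace (2 ^ (2 * S k) * (odd_harmonic 1 m + / 2 * harm a k) /
    ((INR k + 1) * (INR k + 1 + 1) * (INR k + 1 + 2) * (INR k + 1 + 3) *
     central_binom (S k + m) * Binomial.C (S k + m) m)) with
    (2 ^ (2 * S k) / (central_binom (S k + m) * Binomial.C (S k + m) m) *
     (odd_harmonic 1 m + / 2 * harm a k) /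
     ((INR k + 1) * (INR k + 1 + 1) * (INR k + 1 + 2) * (INR k + 1 + 3)))
    by (field; lra).
  rewrite E. field; lra.
Qed.

Theorem theorem16 :
  (forall m : nat,
    is_series_from1
      (fun n : nat =>
         2 ^ (2 * n) * odd_harmonic 1 (n + m) /
         (INR n * (INR n + 1) * (INR n + 2) * (INR n + 3) *
          central_binom (n + m) * Binomial.C (n + m) m))
      (1 / (2 * central_binom m) *
         (1 / 6 * (INR m - 1 / 2) * (INR m + 1 / 2) * (INR m + 3 / 2)
            * odd_harmonic 1 m
          - INR m ^ 2 / 4 - INR m / 4 + 1 / 48) *
         (4 * odd_harmonic 2 m - 3 * zeta 2)
       + 1 / (12 * central_binom m) *
         (INR m - 1 / 2) * (INR m + 1 / 2) * (INR m + 3 / 2) *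
         (8 * odd_harmonic 3 m - 7 * zeta 3)
       + 1 / (2 * central_binom m) *
         (1 / 36 * (6 * INR m ^ 2 + 9 * INR m - 2) * odd_harmonic 1 m
          - INR m / 6 - 1 / 8)))
  /\
  is_series_from1
    (fun n : nat =>
       2 ^ (2 * n) * odd_harmonic 1 n /
       (INR n * (INR n + 1) * (INR n + 2) * (INR n + 3) * central_binom n))
    (7 / 32 * zeta 3 - PI ^ 2 / 192 - 1 / 16)
  /\
  is_series_from1
    (fun n : nat =>
       2 ^ (2 * n) * odd_harmonic 1 (n + 1) /
       (INR n * (INR n + 1) ^ 2 * (INR n + 2) * (INR n + 3) *
        central_binom (n + 1)))
    (137 / 288 + PI ^ 2 / 48 - 35 / 64 * zeta 3).
Proof.
  assert (Hbinom0 : forall n, Binomial.C (n + 0) 0 = 1).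
  { intros n. rewrite pascal_step1, Nat.sub_0_r by lia.
    unfold Binomial.C. rewrite Nat.sub_diag. simpl.
    pose proof (INR_fact_lt_0 (n + 0)). field; lra. }
  assert (Hbinom1 : forall n, Binomial.C (n + 1) 1 = INR n + 1).
  { intros n. induction n as [|n IH].
    - unfold Binomial.C; simpl; field.
    - rewrite binom_add_S, IH, !S_INR. pose proof (pos_INR n). simpl. field; lra. }
  assert (Hcb0 : central_binom 0 = 1)
    by (unfold central_binom, Binomial.C; simpl; field).
  split; [exact is_series_central_binom|]. split.
  - pose proof (is_series_central_binom 0) as H.
    rewrite !odd_harmonic_0, Hcb0, zeta_2 in H.
    match type of H with is_series_from1 _ ?x =>
      match goal with |- is_series_from1 _ ?y => replace y with x end end.
    2: { simpl. field. }
    apply is_series_ext with (2 := H). intros k. refine (_ : @eq R _ _).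
    rewrite Hbinom0, Nat.add_0_r. now rewrite Rmult_1_r.
  (* For m = 1 the factor binom(n+1, 1) = n + 1 produces the square in the denominator. *)
  - pose proof (is_series_central_binom 1) as H.
    rewrite !odd_harmonic_S, !odd_harmonic_0, central_binom_S, Hcb0, zeta_2 in H.
    match type of H with is_series_from1 _ ?x =>
      match goal with |- is_series_from1 _ ?y => replace y with x end end.
    2: { simpl. field. }
    apply is_series_ext with (2 := H). intros k. refine (_ : @eq R _ _).
    rewrite Hbinom1. f_equal. ring.
Qed.
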